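(* Let $G$ be a finite simple graph with vertex set $\{x_1,\ldots,x_n\}$, let $S = \mathbb{K}[x_1,\ldots,x_n]$ with $\mathbb{K}$ a field, let $I(G)$ and $J(G)$ be the edge ideal and the cover ideal of $G$ in $S$, and let $h$ be the size of the smallest vertex cover of $G$. Then for all $s \geq 1$: (i) $e\left(\dfrac{S}{I(G)^{(s)}}\right) = \dbinom{h+s-1}{h}\,\mathcal{V}(G)$, where $\mathcal{V}(G)$ is the number of minimal vertex covers of $G$ of minimal size (i.e. vertex covers of cardinality $h$); (ii) $e\left(\dfrac{S}{J(G)^{(s)}}\right) = \dbinom{s+1}{2}\,|E(G)|$.
   Context: Vertices are identified with the variables of the standard graded polynomial ring $S$. The edge ideal is $I(G) = (x_ix_j \mid \{x_i,x_j\} \in E(G))$ and the cover ideal is $J(G) = \left(\prod_{x \in w} x \mid w \text{ a minimal vertex cover of } G\right)$; equivalently $J(G) = \bigcap_{\{x_i,x_j\} \in E(G)} (x_i,x_j)$. The $s$-th symbolic power of an ideal $I$ is $I^{(s)} = \bigcap_{\mathfrak{p} \in \operatorname{Ass}(S/I)} (I^s S_{\mathfrak{p}} \cap S)$; for a squarefree monomial ideal, $I^{(s)} = \bigcap_{\mathfrak{p} \in \operatorname{Ass}(S/I)} \mathfrak{p}^s$. For a finitely generated graded $S$-module $N$ of dimension $d$ with Hilbert series $\sum_{k} \dim_{\mathbb{K}}(N_k)t^k = h_N(t)/(1-t)^d$, $h_N(t) \in \mathbb{Z}[t]$, the multiplicity is $e(N) = h_N(1)$. *)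

(* Defs.v *)
From mathcomp Require Import all_boot all_order all_algebra.
From mathcomp Require Import fraction mpoly.

Set Implicit Arguments.
Unset Strict Implicit.
Unset Printing Implicit Defensive.

Import GRing.Theory.

Local Open Scope ring_scope.

(* Ideals of a commutative ring are Prop-valued predicates (membership need
   not be decidable). *)

Definition ideal_gen (S : comNzRingType) (A : S -> Prop) (f : S) : Prop :=
  exists (r : nat) (c a : 'I_r -> S),
    (forall i, A (a i)) /\ f = \sum_(i < r) c i * a i.

Definition is_ideal (S : comNzRingType) (I : S -> Prop) : Prop :=
  [/\ I 0, forall f g, I f -> I g -> I (f + g) & forall c f, I f -> I (c * f)].

Definition is_prime_ideal (S : comNzRingType) (p : S -> Prop) : Prop :=
  [/\ is_ideal p, ~ p 1 & forall f g, p (f * g) -> p f \/ p g].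

Definition ideal_pow (S : comNzRingType) (I : S -> Prop) (s : nat) : S -> Prop :=
  ideal_gen (fun f => exists g : 'I_s -> S,
    (forall i, I (g i)) /\ f = \prod_(i < s) g i).

(* p is in Ass(S/I): a prime that is the annihilator of the class of some f. *)
Definition is_associated_prime (S : comNzRingType) (I p : S -> Prop) : Prop :=
  is_prime_ideal p /\ exists f, forall g, p g <-> I (g * f).

(* The extension I S_p, as a subset of the fraction field of the domain S. *)
Definition localized_ideal (S : idomainType) (I p : S -> Prop)
    (z : {fraction S}) : Prop :=
  exists a g : S, [/\ I a, ~ p g & z = tofrac a / tofrac g].

Definition symbolic_power (S : idomainType) (I : S -> Prop) (s : nat) (f : S)
    : Prop :=
  forall p : S -> Prop, is_associated_prime I p ->
    localized_ideal (ideal_pow I s) p (tofrac f).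

(* A strict chain p_0 < p_1 < ... < p_l of primes containing I. *)
Definition prime_chain (S : comNzRingType) (I : S -> Prop) (l : nat)
    (p : nat -> S -> Prop) : Prop :=
  (forall i, (i <= l)%N -> is_prime_ideal (p i) /\ forall f, I f -> p i f) /\
  (forall i, (i < l)%N ->
     (forall f, p i f -> p i.+1 f) /\ exists f, p i.+1 f /\ ~ p i f).

(* d is the Krull dimension of S/I. Convention: the zero module (1 \in I) has
   dimension 0, so that its multiplicity below is 0. *)
Definition is_krull_dim (S : comNzRingType) (I : S -> Prop) (d : nat) : Prop :=
  ((exists p, prime_chain I d p) \/ (d = 0%N /\ I 1)) /\
  (forall l p, prime_chain I l p -> (l <= d)%N).

(* (S/I)_k has dimension m over K: there are m forms of degree k whose classes
   modulo I are a K-basis of the image of S_k in S/I. *)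
Definition is_graded_dim (K : fieldType) (n : nat) (I : {mpoly K[n]} -> Prop)
    (k m : nat) : Prop :=
  exists b : 'I_m -> {mpoly K[n]},
    [/\ forall i, b i \is k.-homog,
        forall c : 'I_m -> K, I (\sum_(i < m) c i *: b i) -> forall i, c i = 0
      & forall f, f \is k.-homog ->
          exists c : 'I_m -> K, I (f - \sum_(i < m) c i *: b i)].

(* e(S/I) = e. The identity \sum_k HF k * t^k = h / (1 - t)^d of formal power
   series is written coefficientwise, after multiplying by (1 - t)^d. *)
Definition is_multiplicity (K : fieldType) (n : nat) (I : {mpoly K[n]} -> Prop)
    (e : int) : Prop :=
  exists (d : nat) (HF : nat -> nat) (h : {poly int}),
    [/\ is_krull_dim I d,
        forall k, is_graded_dim I k (HF k),
        forall k, \sum_(i < k.+1) ((1 - 'X) ^+ d : {poly int})`_i * (HF (k - i)%N)%:Z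
                  = h`_k
      & e = h.[1]].

(* A simple graph on the vertex set 'I_n is a symmetric irreflexive e : rel 'I_n. *)

Definition edge_set (n : nat) (e : rel 'I_n) : {set {set 'I_n}} :=
  [set [set p.1; p.2] | p : 'I_n * 'I_n & e p.1 p.2].

Definition vertex_cover (n : nat) (e : rel 'I_n) (w : {set 'I_n}) : bool :=
  [forall i, forall j, e i j ==> (i \in w) || (j \in w)].

Definition cover_number (n : nat) (e : rel 'I_n) : nat :=
  #|[arg min_(w < [set: 'I_n] | vertex_cover e w) #|w|]|.

Definition num_minimum_covers (n : nat) (e : rel 'I_n) : nat :=
  #|[set w : {set 'I_n} |
      minset (vertex_cover e) w & #|w| == cover_number e]|.

Definition edge_ideal (K : fieldType) (n : nat) (e : rel 'I_n)
    : {mpoly K[n]} -> Prop :=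
  ideal_gen (fun f : {mpoly K[n]} => exists i j, e i j /\ f = 'X_i * 'X_j).

Definition cover_ideal (K : fieldType) (n : nat) (e : rel 'I_n)
    : {mpoly K[n]} -> Prop :=
  ideal_gen (fun f : {mpoly K[n]} =>
    exists w : {set 'I_n},
      minset (vertex_cover e) w /\ f = \prod_(i in w) 'X_i).

Arguments edge_ideal K {n} e _ : assert.
Arguments cover_ideal K {n} e _ : assert.

(* Main.v *)
Require Import Defs.
From mathcomp Require Import all_boot all_order all_algebra.
From mathcomp Require Import mpoly.
From mathcomp Require Import fraction zify.
From Stdlib Require Import Classical FunctionalExtensionality PropExtensionality.

(** Both ideals are intersections of primes P_w generated by sets w of
    variables: w runs over the minimal vertex covers for I(G) and over the edges
    for J(G). Since no w contains another, the P_w are exactly the associated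
    primes, and the s-th symbolic power is spanned by the monomials whose degree
    in the variables of each w is at least s. The quotient has the other monomials
    as a basis; grouping them by their exponents truncated at s writes its Hilbert
    series as the finite sum of t^|g| / (1 - t)^|Z(g)| over the truncated exponents
    g of such monomials, with Z(g) the set of variables truncated to s. The pole
    order is maximal exactly when the complement of Z(g) is some w of minimal size
    c, where the exponents on w have sum < s, giving binom(c+s-1, c) choices.

    For the Krull dimension, a chain p_0 < ... < p_l gives N^l polynomials of
    degree O(N), linearly independent modulo p_0, while p_0 contains some P_w, so
    that N^l = O(N^(n-|w|)). *)

Section SquarefreeSymbolicPowers.

Set Implicit Arguments.
Unset Strict Implicit.
Unset Printing Implicit Defensive.
Import GRing.Theory.
Local Open Scope ring_scope.

(** * Ideals and their generators *)

Section Ideals.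

Variable R : comNzRingType.
Implicit Types I A : R -> Prop.

Lemma ideal_sum I (T : Type) (r : seq T) (P : pred T)
    (F : T -> R) :
  is_ideal I -> (forall i, P i -> I (F i)) -> I (\sum_(i <- r | P i) F i).
Proof. by case=> I0 ID _ IF; elim/big_ind: _ => // x y; apply: ID. Qed.

Lemma ideal_gen_is_ideal A : is_ideal (ideal_gen A).
Proof.
split.
- by exists 0%N, (fun=> 0), (fun=> 0); split; [case | rewrite big_ord0].
- move=> _ _ [r [c [a [Aa ->]]]] [r' [c' [a' [Aa' ->]]]].
  exists (r + r')%N.
  exists (fun i => match split i with inl j => c j | inr j => c' j end).
  exists (fun i => match split i with inl j => a j | inr j => a' j end).
  split=> [i|]; first by case: (split i).
  rewrite big_split_ord /=; congr (_ + _); apply: eq_bigr => i _.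
    by have /= -> := unsplitK (inl i : 'I_r + 'I_r').
  by have /= -> := unsplitK (inr i : 'I_r + 'I_r').
- move=> b _ [r [c [a [Aa ->]]]]; exists r, (fun i => b * c i), a; split=> //.
  by rewrite mulr_sumr; apply: eq_bigr => i _; rewrite mulrA.
Qed.

Lemma ideal_gen_mem A f : A f -> ideal_gen A f.
Proof.
by move=> Af; exists 1%N, (fun=> 1), (fun=> f); split=> //; rewrite big_ord1 mul1r.
Qed.

Lemma ideal_gen_sub A I f :
  is_ideal I -> (forall a, A a -> I a) -> ideal_gen A f -> I f.
Proof.
move=> idI AI [r [c [a [Aa ->]]]]; apply: ideal_sum => // i _.
by case: idI => _ _; apply; apply: AI.
Qed.

End Ideals.

(** * Powers of the primes generated by variables *)

Section WeightIdeals.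

Variables (K : fieldType) (n : nat).
Implicit Types (f g : {mpoly K[n]}) (w u : {set 'I_n}) (m : 'X_{1..n}) (s k : nat).

Definition wdeg w m : nat := (\sum_(i in w) m i)%N.

(* The [s]-th power of the prime generated by the variables in [w]. *)
Definition wideal w s f : Prop := forall m, m \in msupp f -> (s <= wdeg w m)%N.

Definition rees_var w (i : 'I_n) : {poly {mpoly K[n]}} :=
  if i \in w then 'X * ('X_i)%:P else ('X_i)%:P.

(* The substitution X_i |-> t X_i (i in w) turns the order of vanishing along
   [w] into the order in [t]. *)
Definition rees w f : {poly {mpoly K[n]}} :=
  mmap (polyC \o @mpolyC n K) (rees_var w) f.

Lemma reesM w f g : rees w (f * g) = rees w f * rees w g.
Proof. exact: rmorphM. Qed.

Lemma rees_monomial w m : mmap1 (rees_var w) m = 'X^(wdeg w m) * ('X_[m])%:P.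
Proof.
rewrite mpolyXE_id rmorph_prod /= /mmap1 /wdeg -prodrXr.
rewrite [\prod_(i in w) _]big_mkcond -big_split /=.
apply: eq_bigr => i _; rewrite /rees_var rmorphXn /=; case: ifP => _.
  by rewrite exprMn.
by rewrite mul1r.
Qed.

Lemma coef_rees w f k m :
  ((rees w f)`_k)@_m = if wdeg w m == k then f@_m else 0.
Proof.
rewrite /rees /mmap coef_sum raddf_sum /=.
under eq_bigr => m' _ do
  rewrite rees_monomial mulrCA -polyCM coefMC coefXn mulr_natl mcoeffMn
    mul_mpolyC mcoeffZ mcoeffX.
have [ms | ms] := boolP (m \in msupp f); last first.
  rewrite (memN_msupp_eq0 ms) if_same big_seq big1 // => m' m'f.
  by have [e|] := eqVneq m' m; [rewrite -e m'f in ms | rewrite mulr0 mul0rn].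
rewrite (bigD1_seq m) ?msupp_uniq //= eqxx mulr1 big1 => [|m' /negPf->].
  by rewrite addr0 eq_sym; case: eqP.
by rewrite mulr0 mul0rn.
Qed.

Lemma wideal_rees w s f :
  wideal w s f <-> forall k, (k < s)%N -> (rees w f)`_k = 0.
Proof.
split=> [fs k ks | f0 m mf].
  apply/mpolyP => m; rewrite coef_rees mcoeff0; case: eqP => // e.
  by apply/eqP; rewrite mcoeff_eq0; apply/negP => /fs; rewrite e leqNgt ks.
rewrite leqNgt; apply/negP => /f0 /(congr1 (mcoeff m)).
by rewrite coef_rees eqxx mcoeff0; apply/eqP; rewrite -mcoeff_msupp.
Qed.

Lemma widealM w s s' f g :
  wideal w s f -> wideal w s' g -> wideal w (s + s') (f * g).
Proof.
move=> /wideal_rees fs /wideal_rees gs; apply/wideal_rees => k ks.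
rewrite reesM; move: (rees w f) (rees w g) fs gs => p q ps qs.
rewrite coefM big1 // => i _; have [lis | si] := ltnP i s.
  by rewrite ps // mul0r.
rewrite qs ?mulr0 //; have := ltn_ord i; rewrite ltnS => ik.
by rewrite ltn_subLR // (leq_trans ks) // leq_add2r.
Qed.

(** Powers of P_w are P_w-primary: [rees w g] has a nonzero constant term in t, so the coefficients
    of [rees w f] below degree s vanish one after the other, by induction on k. *)
Lemma wideal_cancel w s f g :
  wideal w s (f * g) -> ~ wideal w 1 g -> wideal w s f.
Proof.
move=> /wideal_rees fg g1; apply/wideal_rees.
have g0 : (rees w g)`_0 != 0.
  by apply/eqP => g0; apply: g1; apply/wideal_rees => -[|].
rewrite reesM in fg; move: (rees w f) (rees w g) fg g0 => p q pq q0.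
elim/ltn_ind => k IH ks; have := pq k ks.
rewrite coefM big_ord_recr /= subnn big1 => [|i _]; last first.
  by rewrite IH ?mul0r //; apply: ltn_trans ks.
by rewrite add0r => /eqP; rewrite mulf_eq0 (negPf q0) orbF => /eqP.
Qed.

Lemma wideal_is_ideal w s : is_ideal (wideal w s).
Proof.
split=> [m|f g fs gs m|c f fs]; first by rewrite msupp0.
  by move/msuppD_le; rewrite mem_cat => /orP[/fs|/gs].
by rewrite -[s]add0n; apply: widealM.
Qed.

Lemma widealX w s m : wideal w s 'X_[m] <-> (s <= wdeg w m)%N.
Proof.
split=> [|sm m' /mem_msuppXP <- //].
by apply; rewrite msuppX mem_head.
Qed.

Lemma wdegU w i : wdeg w U_(i)%MM = (i \in w).
Proof.
rewrite /wdeg; have [iw|iw] := boolP (i \in w).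
  rewrite (bigD1 i) //= mnm1E eqxx big1 ?addn0 // => j /andP[_ ji].
  by rewrite mnm1E eq_sym (negPf ji).
rewrite big1 // => j jw; rewrite mnm1E; case: eqP => // e.
by rewrite e jw in iw.
Qed.

Lemma wdeg_gt0P w m : reflect (exists2 i, i \in w & m i != 0%N) (0 < wdeg w m)%N.
Proof.
rewrite lt0n sum_nat_eq0; apply: (iffP forall_inPn) => -[i iw mi]; by exists i.
Qed.

Lemma wideal_prime w : is_prime_ideal (wideal w 1).
Proof.
split; first exact: wideal_is_ideal.
  move/(_ 0%MM); rewrite msupp1 mem_head => /(_ isT)/wdeg_gt0P[i _].
  by rewrite mnm0E.
move=> f g fg; have [?|g1] := classic (wideal w 1 g); first by right.
by left; apply: wideal_cancel g1.
Qed.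

Lemma ideal_msupp (I : {mpoly K[n]} -> Prop) f :
  is_ideal I -> (forall m, m \in msupp f -> I 'X_[m]) -> I f.
Proof.
move=> idI If; rewrite (mpolyE f) big_seq; apply: ideal_sum => // m /If Im.
by rewrite -mul_mpolyC; case: idI => _ _; apply.
Qed.

Lemma wideal_sub_ideal w (I : {mpoly K[n]} -> Prop) f :
  is_ideal I -> (forall i, i \in w -> I 'X_i) -> wideal w 1 f -> I f.
Proof.
move=> idI Iw f1; apply: ideal_msupp => // m /f1 /wdeg_gt0P[i iw mi].
rewrite -(@submK _ U_(i) m) ?lep1mP //.
by rewrite mpolyXD; case: idI => _ _; apply; apply: Iw.
Qed.

End WeightIdeals.

(** * Associated primes and symbolic powers of intersections of the P_w *)

Section SymbolicPowers.

Lemma ideal_colon (R : comNzRingType) (I : R -> Prop) a :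
  is_ideal I -> is_ideal (fun b => I (a * b)).
Proof.
case=> I0 ID IM; split=> [|f g|c f]; first by rewrite mulr0.
  by rewrite mulrDr; apply: ID.
by rewrite mulrCA; apply: IM.
Qed.

Lemma ideal_pow0 (R : comNzRingType) (I : R -> Prop) f : ideal_pow I 0 f.
Proof.
exists 1%N, (fun=> f), (fun=> 1); split=> [_|]; last by rewrite big_ord1 mulr1.
by exists (fun=> 0); split=> [[]//|]; rewrite big_ord0.
Qed.

Lemma ideal_powS (R : comNzRingType) (I : R -> Prop) s a b :
  I a -> ideal_pow I s b -> ideal_pow I s.+1 (a * b).
Proof.
move=> Ia; apply: (@ideal_gen_sub R _ (fun b => ideal_pow I s.+1 (a * b))).
  by apply: ideal_colon; apply: ideal_gen_is_ideal.
move=> _ [g [Ig ->]]; apply: ideal_gen_mem.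
exists (fun i => if unlift ord0 i is Some j then g j else a); split=> [i|].
  by case: unliftP.
rewrite big_ord_recl unlift_none; congr (_ * _).
by apply: eq_bigr => i _; rewrite liftK.
Qed.

Variables (K : fieldType) (n : nat).
Implicit Types (f g : {mpoly K[n]}) (w u : {set 'I_n}) (m : 'X_{1..n}) (s k : nat).
Implicit Types (W : {set {set 'I_n}}).

Definition capw W s f : Prop := forall w, w \in W -> wideal w s f.

Lemma capw_is_ideal W s : is_ideal (capw W s).
Proof.
split=> [w _|f g fs gs w wW|c f fs w wW]; have [I0 ID IM] := wideal_is_ideal K w s.
- exact: I0.
- by apply: ID; [apply: fs | apply: gs].
- by apply: IM; apply: fs.
Qed.

(** Exponent of the product of the variables outside w. For w in an antichain W, this product lies
    in P_u for every other u in W, but not in P_w. *)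
Definition off w : 'X_{1..n} := [multinom nat_of_bool (i \notin w) | i < n].

Lemma wdeg_off u w : (0 < wdeg u (off w))%N = ~~ (u \subset w).
Proof.
apply/wdeg_gt0P/subsetPn => -[i iu]; rewrite ?mnmE.
  by case: (i \in w) / boolP => // iw _; exists i.
by move=> iw; exists i; rewrite // mnmE iw.
Qed.

Lemma off_notin w : ~ wideal w 1 ('X_[off w] : {mpoly K[n]}).
Proof. by rewrite widealX wdeg_off subxx. Qed.

Variable W : {set {set 'I_n}}.
Hypothesis W_antichain : {in W &, forall u w, u \subset w -> u = w}.

Lemma capw_off w f : w \in W -> wideal w 1 f -> capw W 1 ('X_[off w] * f).
Proof.
move=> wW fw u uW; have [->|uw] := eqVneq u w.
  by case: (wideal_is_ideal K w 1) => _ _; apply.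
rewrite mulrC; case: (wideal_is_ideal K u 1) => _ _; apply; apply/widealX.
by rewrite wdeg_off; apply: contra uw => /W_antichain->.
Qed.

(** P_w is the annihilator of the class of the product of the variables outside w. *)
Lemma associated_wideal w : w \in W -> is_associated_prime (capw W 1) (wideal w 1).
Proof.
move=> wW; split; first exact: wideal_prime.
exists 'X_[off w] => g; split=> [gw | /(_ w wW) gw].
  by rewrite mulrC; apply: capw_off.
by apply: wideal_cancel gw _; apply: off_notin.
Qed.

Lemma prime_prod (R : comNzRingType) (p : R -> Prop) (T : Type) (r : seq T)
    (P : pred T) (F : T -> R) :
  is_prime_ideal p -> p (\prod_(i <- r | P i) F i) -> exists2 i, P i & p (F i).
Proof.
move=> [_ p1 pM]; elim/big_ind: _ => [/p1//|x y IHx IHy /pM[/IHx|/IHy]//|i].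
by exists i.
Qed.

(* The colon ideal (I : f) is the intersection of the minimal primes of I not
   containing f; being prime, it is one of them. *)
Lemma associated_is_wideal p : is_associated_prime (capw W 1) p ->
  exists2 w, w \in W & forall g, p g <-> wideal w 1 g.
Proof.
move=> [p_prime [f pE]]; have [p_ideal p1 _] := p_prime.
apply: NNPP => noW.
(* Without such an h, P_w lies in p. Conversely, g in p gives g f in P_w, hence g in P_w. So p would
   equal P_w, against [noW]. *)
have /fin_all_exists[h hP] (w : {set 'I_n}) : exists h, w \in W ->
    ~ wideal w 1 f -> wideal w 1 h /\ ~ p h.
  have [[wW fw] | wf] := classic (w \in W /\ ~ wideal w 1 f); last first.
    by exists 0 => wW fw; case: wf.
  apply: NNPP => no_h; apply: noW; exists w => // g; split=> [/pE/(_ w wW)|gw].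
    move=> gfw; apply: NNPP => gw; apply: fw; rewrite mulrC in gfw.
    exact: wideal_cancel gfw gw.
  by apply: NNPP => pg; apply: no_h; exists g.
(* Membership of f in P_w is only a proposition; classical logic turns it into a finite set over
   which a product can be taken. *)
have [J WJ] : exists J : {set {set 'I_n}},
    forall w, w \in J <-> w \in W /\ ~ wideal w 1 f.
  have /fin_all_exists[b bP] (w : {set 'I_n}) : exists b : bool,
      b <-> w \in W /\ ~ wideal w 1 f.
    by have [?|?] := classic (w \in W /\ ~ wideal w 1 f); [exists true|exists false].
  by exists [set w | b w] => w; rewrite inE; apply: bP.
(* The product times f lies in each P_w, through f or through the factor [h w]. *)
have : p (\prod_(w in J) h w).
  apply/pE => w wW; have [fw | fw] := classic (wideal w 1 f).
    by case: (wideal_is_ideal K w 1) => _ _; apply.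
  have wJ : w \in J by apply/WJ.
  have [hw _] := hP w wW fw; rewrite (bigD1 w) //= -mulrA mulrC.
  by case: (wideal_is_ideal K w 1) => _ _; apply.
move=> /(prime_prod p_prime)[w /WJ[wW fw]].
by case: (hP w wW fw).
Qed.

Lemma ideal_pow_wideal w s f :
  w \in W -> ideal_pow (capw W 1) s f -> wideal w s f.
Proof.
move=> wW; apply: ideal_gen_sub => [|_ [g [gW ->]]]; first exact: wideal_is_ideal.
elim: s g gW => [|s IH] g gW; first by move=> m.
rewrite big_ord_recl; apply: (@widealM _ _ _ 1 s); first exact: gW.
by apply: IH => i; apply: gW.
Qed.

(** Each of s variables of w dividing the monomial is paired with one copy of ['X_[off w]]; every
    such pair lies in the intersection of the primes. *)
Lemma ideal_pow_offX w s m : w \in W -> (s <= wdeg w m)%N ->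
  ideal_pow (capw W 1) s ('X_[off w] ^+ s * 'X_[m]).
Proof.
move=> wW; elim: s m => [|s IH] m sm; first exact: ideal_pow0.
have /wdeg_gt0P[i iw mi] : (0 < wdeg w m)%N by apply: leq_trans sm.
have mE : m = (U_(i) + (m - U_(i)))%MM by rewrite addmC submK ?lep1mP.
rewrite mE mpolyXD exprS mulrACA; apply: ideal_powS.
  by apply: capw_off => //; apply/widealX; rewrite wdegU iw.
apply: IH; move: sm; rewrite {1}mE /wdeg.
under eq_bigr do rewrite mnmDE.
by rewrite big_split /= -/(wdeg w _) wdegU iw.
Qed.

Lemma ideal_pow_off w s f : w \in W -> wideal w s f ->
  ideal_pow (capw W 1) s ('X_[off w] ^+ s * f).
Proof.
move=> wW fs; apply: (@ideal_msupp _ _ (fun f => ideal_pow _ s (_ * f))).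
  by apply: ideal_colon; apply: ideal_gen_is_ideal.
by move=> m /fs; apply: ideal_pow_offX.
Qed.

(** A denominator outside P_w can be cancelled since P_w^s is primary. Conversely, the s-th power of
    ['X_[off w]] serves as denominator. *)
Lemma localized_capw w s f : w \in W ->
  localized_ideal (ideal_pow (capw W 1) s) (wideal w 1) (tofrac f) <->
  wideal w s f.
Proof.
move=> wW; have nz g : ~ wideal w 1 g -> tofrac g != 0.
  rewrite tofrac_eq0 => gw; apply/eqP => g0; apply: gw.
  by rewrite g0 => m; rewrite msupp0.
split=> [[a [g [/(ideal_pow_wideal wW) aI gw]]]|fs].
  move/(congr1 (fun z => z * tofrac g)); rewrite divfK ?nz // -tofracM => /eqP.
  rewrite tofrac_eq => /eqP fg.
  by apply: (@wideal_cancel _ _ _ _ _ g); rewrite ?fg.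
have gw : ~ wideal w 1 ('X_[off w] ^+ s : {mpoly K[n]}).
  rewrite -(card_ord s) -prodr_const => /(prime_prod (wideal_prime K w))[_ _].
  exact: off_notin.
exists ('X_[off w] ^+ s * f), ('X_[off w] ^+ s); split=> //.
  exact: ideal_pow_off.
by rewrite tofracM mulrC mulKf // nz.
Qed.

Lemma symbolic_power_capw s : symbolic_power (capw W 1) s = capw W s.
Proof.
apply: functional_extensionality => f; apply: propositional_extensionality.
split=> [fs w wW | fs p /associated_is_wideal[w wW pE]].
  by apply/localized_capw => //; apply: fs; apply: associated_wideal.
have -> : p = wideal w 1.
  by apply: functional_extensionality => g; apply: propositional_extensionality.
by apply/localized_capw => //; apply: fs.
Qed.

End SymbolicPowers.

(** * Prime decompositions of the edge and cover ideals *)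

Section EdgeAndCoverIdeals.

Variables (K : fieldType) (n : nat) (e : rel 'I_n).
Implicit Types (f g : {mpoly K[n]}) (w u : {set 'I_n}) (m : 'X_{1..n}).

Definition min_covers : {set {set 'I_n}} := [set w | minset (vertex_cover e) w].

Lemma vertex_coverP w :
  reflect (forall i j, e i j -> i \in w \/ j \in w) (vertex_cover e w).
Proof.
apply: (iffP forallP) => [ew i j eij | ew i].
  by have /forallP/(_ j)/implyP/(_ eij)/orP := ew i.
by apply/forallP => j; apply/implyP => /ew/orP.
Qed.

Lemma edge_setP w : reflect (exists i j, e i j /\ w = [set i; j]) (w \in edge_set e).
Proof.
apply: (iffP imsetP) => [[[i j] eij ->] | [i [j [eij ->]]]].
  by move: eij; rewrite inE => eij; exists i, j.
by exists (i, j); rewrite ?inE.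
Qed.

Lemma widealMl w s f g : wideal w s f -> wideal w s (f * g).
Proof. by move=> fs; rewrite mulrC; case: (wideal_is_ideal K w s) => _ _; apply. Qed.

Lemma widealU w i : i \in w -> wideal w 1 ('X_i : {mpoly K[n]}).
Proof. by move=> iw; apply/widealX; rewrite wdegU iw. Qed.

Lemma ideal_monomial (I : {mpoly K[n]} -> Prop) m m' :
  is_ideal I -> (m <= m')%MM -> I 'X_[m] -> I 'X_[m'].
Proof. by case=> _ _ IM /submK <-; rewrite mpolyXD; apply: IM. Qed.

Lemma min_covers_antichain : {in min_covers &, forall u w, u \subset w -> u = w}.
Proof.
move=> u w; rewrite !inE => /minsetp cu mw uw.
exact: minsetinf mw cu uw.
Qed.

Lemma card_edge w : irreflexive e -> w \in edge_set e -> #|w| = 2%N.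
Proof.
move=> e_irr /edge_setP[i [j [eij ->]]]; rewrite cards2.
by case: eqVneq eij => [->|//]; rewrite e_irr.
Qed.

Lemma edge_set_antichain : irreflexive e ->
  {in edge_set e &, forall u w, u \subset w -> u = w}.
Proof.
by move=> e_irr u w ue we uw; apply/eqP; rewrite eqEcard uw !card_edge.
Qed.

Lemma edge_ideal_capw : irreflexive e -> edge_ideal K e = capw min_covers 1.
Proof.
move=> e_irr; apply: functional_extensionality => f.
apply: propositional_extensionality.
split=> [|fW].
  apply: ideal_gen_sub => [|_ [i [j [eij ->]]] w]; first exact: capw_is_ideal.
  rewrite inE => /minsetp/vertex_coverP/(_ _ _ eij)[iw|jw].
    by apply: widealMl; apply: widealU.
  by rewrite mulrC; apply: widealMl; apply: widealU.
have idI : is_ideal (edge_ideal K e) by apply: ideal_gen_is_ideal.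
apply: ideal_msupp => // m mf.
have [i [j [eij mi mj]]] : exists i j, [/\ e i j, m i != 0%N & m j != 0%N].
  (* If the support of m contained no edge, its complement would be a vertex cover, and m would have
     degree 0 on a minimal cover inside it. *)
  apply: NNPP => no_ij; have : vertex_cover e [set i | m i == 0%N].
    apply/vertex_coverP => i j eij; rewrite !inE.
    have [_ | mi] := eqVneq (m i) 0%N; [by left | right].
    by apply: contraT => mj; case: no_ij; exists i, j.
  case/minset_exists => w mw /subsetP wZ.
  have /wdeg_gt0P[i /wZ] : (0 < wdeg w m)%N by apply: fW; rewrite ?inE.
  by rewrite inE => ->.
(* For a loop, positive exponents would not make x_i x_j divide the monomial. *)
have ij : i != j by case: eqVneq eij => [->|//]; rewrite e_irr.
apply: (@ideal_monomial _ (U_(i) + U_(j))%MM) => //.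
  apply/mnm_lepP => k; rewrite mnmDE !mnm1E.
  case: (eqVneq i k) => [<-|_]; last by case: eqVneq => [<-|]; rewrite // lt0n.
  by rewrite eq_sym (negPf ij) lt0n.
by rewrite mpolyXD; apply: ideal_gen_mem; exists i, j.
Qed.

Lemma prod_varE w : \prod_(i in w) 'X_i = 'X_[off (~: w)] :> {mpoly K[n]}.
Proof.
rewrite mpolyXE_id big_mkcond; apply: eq_bigr => i _.
by rewrite mnmE inE negbK; case: ifP; rewrite ?expr0 ?expr1.
Qed.

Lemma cover_ideal_capw : cover_ideal K e = capw (edge_set e) 1.
Proof.
apply: functional_extensionality => f; apply: propositional_extensionality.
split=> [|fW].
  apply: ideal_gen_sub => [|_ [w [/minsetp/vertex_coverP cw ->]] u].
    exact: capw_is_ideal.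
  case/edge_setP => i [j [/cw ijw ->]].
  have [k kw ku] : exists2 k, k \in w & k \in [set i; j].
    by case: ijw => ?; [exists i | exists j]; rewrite ?set21 ?set22.
  by rewrite (bigD1 k) //=; apply: widealMl; apply: widealU.
have idI : is_ideal (cover_ideal K e) by apply: ideal_gen_is_ideal.
apply: ideal_msupp => // m mf.
(* The support of m meets every edge; the generator of a minimal cover inside the support divides
   the monomial. *)
have /minset_exists[w mw /subsetP wZ] : vertex_cover e [set i | m i != 0%N].
  apply/vertex_coverP => i j eij; rewrite !inE.
  have /wdeg_gt0P[k] : (0 < wdeg [set i; j] m)%N.
    by apply: fW => //; apply/edge_setP; exists i, j.
  by rewrite !inE => /orP[]/eqP->; [left | right].
apply: (@ideal_monomial _ (off (~: w))) => //.
  apply/mnm_lepP => k; rewrite mnmE inE negbK.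
  by case: (boolP (k \in w)) => // /wZ; rewrite inE lt0n.
by rewrite -prod_varE; apply: ideal_gen_mem; exists w.
Qed.

End EdgeAndCoverIdeals.

(** * Krull dimension by growth of independent families *)

Section KrullDimension.

(** Modulo q only the term [r 0] of the sum survives, so it is 0; then x, which is outside the prime
    p, can be cancelled and the argument repeated. *)
Lemma power_independent (R : comNzRingType) (p q : R -> Prop) x N (r : 'I_N -> R) :
  is_prime_ideal p -> is_ideal q -> (forall f, p f -> q f) -> q x -> ~ p x ->
  (forall a, q (r a) -> r a = 0) ->
  p (\sum_(a < N) x ^+ a * r a) -> forall a, r a = 0.
Proof.
move=> p_prime q_ideal pq qx px; have [_ qD qM] := q_ideal; have [_ _ pM] := p_prime.
elim: N r => [|N IH] r rq; first by move=> _ [].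
rewrite big_ord_recl expr0 mul1r.
under eq_bigr do rewrite exprS -mulrA.
rewrite -mulr_sumr => psum; have r0 : r ord0 = 0.
  apply: rq; rewrite -(addrK (x * \sum_(i < N) x ^+ i * r (lift ord0 i)) (r ord0)).
  by apply: qD; [apply: pq | rewrite -mulrN mulrC; apply: qM].
move: psum; rewrite r0 add0r => /pM[//|/IH rl] a.
by case: (unliftP ord0 a) => [j|] -> //; apply: rl => b; apply: rq.
Qed.

Variables (K : fieldType) (n : nat).
Implicit Types (f g : {mpoly K[n]}) (w u : {set 'I_n}) (m : 'X_{1..n}) (s k : nat).

Lemma msizeM_leS f g a b :
  (msize f <= a.+1 -> msize g <= b.+1 -> msize (f * g) <= (a + b).+1)%N.
Proof.
move=> fa gb; have [->|f0] := eqVneq f 0; first by rewrite mul0r msize0.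
have [->|g0] := eqVneq g 0; first by rewrite mulr0 msize0.
by rewrite msizeM //; have := leq_add fa gb; rewrite addSn addnS; case: (_ + _)%N.
Qed.

Lemma msizeXn_le f a : (msize (f ^+ a) <= (msize f * a).+1)%N.
Proof.
elim: a => [|a IH]; first by rewrite expr0 msize1.
by rewrite exprS mulnS; apply: msizeM_leS.
Qed.

(* Monomials in elements x_i of p_(i+1) outside p_i are linearly independent
   modulo p_0; there are N^l of them with all exponents below N. *)
Lemma chain_independent l (p : nat -> {mpoly K[n]} -> Prop) :
  (forall i, (i <= l)%N -> is_prime_ideal (p i)) ->
  (forall i, (i < l)%N ->
     (forall f, p i f -> p i.+1 f) /\ exists f, p i.+1 f /\ ~ p i f) ->
  exists D, forall N, exists (J : finType) (b : J -> {mpoly K[n]}),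
    [/\ #|J| = (N ^ l)%N, forall j, (msize (b j) <= (D * N).+1)%N
      & forall c : J -> K, p 0%N (\sum_j c j *: b j) -> forall j, c j = 0].
Proof.
elim: l p => [|l IH] p p_prime p_lt.
  exists 0%N => N; exists unit, (fun=> 1); split=> [|_|c]; first by rewrite card_unit.
    by rewrite msize1.
  rewrite (bigD1 tt) //= big1 ?addr0 => [pc [] | []//].
  have [[_ _ pM] p1 _] := p_prime 0%N isT; apply: NNPP => /eqP c0; apply: p1.
  by rewrite -(scale1r 1) -(mulVf c0) -scalerA -mul_mpolyC; apply: pM.
have [|i il|D DP] := IH (fun i => p i.+1); first by move=> i il; apply: p_prime.
  exact: p_lt.
have [p01 [x [p1x p0x]]] := p_lt 0%N isT.
exists (msize x + D)%N => N; have [J [b [cardJ size_b b_indep]]] := DP N.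
exists ('I_N * J)%type, (fun aj : 'I_N * J => x ^+ aj.1 * b aj.2).
split=> [|[a j] /=|c pc [a j]].
- by rewrite card_prod card_ord cardJ expnS.
- rewrite mulnDl; apply: msizeM_leS => //; apply: leq_trans (msizeXn_le _ _) _.
  by rewrite ltnS leq_mul2l (ltnW (ltn_ord a)) orbT.
have p1_ideal : is_ideal (p 1%N) by case: (p_prime 1%N isT).
apply: (b_indep (fun j => c (a, j))).
pose r a := \sum_j c (a, j) *: b j.
suff /(_ a) : forall a, r a = 0 by rewrite /r => ->; case: p1_ideal.
apply: (power_independent (p_prime 0%N isT) p1_ideal p01 p1x p0x) => [a' qr|].
  by rewrite /r big1 // => j' _; rewrite (b_indep _ qr) scale0r.
rewrite (eq_bigr (fun a => \sum_j c (a, j) *: (x ^+ a * b j))) => [|a' _].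
  by rewrite pair_big; move: pc; congr (p _ _); apply: eq_bigr => -[].
by rewrite mulr_sumr; apply: eq_bigr => j' _; rewrite scalerAr.
Qed.

Lemma mnm_le_mdeg m i : (m i <= mdeg m)%N.
Proof. by rewrite mdegE (bigD1 i) //= leq_addr. Qed.

(** Since [msize] is the degree plus one, the [b j] have degree at most D. Modulo P_w only monomials
    in the other variables matter, with exponents at most D. A larger family has more rows than
    columns in its coefficient matrix, hence a relation modulo P_w. *)
Lemma independent_card w D (J : finType) (b : J -> {mpoly K[n]}) :
  (forall j, msize (b j) <= D.+1)%N ->
  (forall c : J -> K, wideal w 1 (\sum_j c j *: b j) -> forall j, c j = 0) ->
  (#|J| <= D.+1 ^ (n - #|w|))%N.
Proof.
move=> size_b b_indep; pose T := {ffun {i | i \in ~: w} -> 'I_D.+1}.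
have <- : #|T| = (D.+1 ^ (n - #|w|))%N.
  rewrite card_ffun card_ord card_sig; congr (_ ^ _)%N.
  by rewrite -[X in (X - _)%N](card_ord n) -(cardsC w) addKn; apply: eq_card.
rewrite leqNgt; apply/negP => ltTJ.
pose mon (t : T) : 'X_{1..n} :=
  [multinom if insub i is Some i' then nat_of_ord (t i') else 0%N | i < n].
pose A := \matrix_(j < #|J|, t < #|T|) (b (enum_val j))@_(mon (enum_val t)).
have /rowV0Pn[v /sub_kermxP vA /eqP v0] : kermx A != 0.
  rewrite kermx_eq0 /row_free neq_ltn.
  by rewrite (leq_ltn_trans (rank_leq_col A) ltTJ).
apply: v0; apply/rowP => j; rewrite mxE -(enum_valK j).
apply: (b_indep (fun j => v 0 (enum_rank j))) => m.
rewrite mcoeff_msupp raddf_sum /= lt0n; apply: contra => /eqP w0.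
have [mD | Dm] := leqP (mdeg m) D; last first.
  rewrite big1 // => j' _; rewrite mcoeffZ memN_msupp_eq0 ?mulr0 //.
  by rewrite msize_mdeg_ge // (leq_trans (size_b j')).
pose t : T := [ffun i => inord (m (val i))].
have tm : mon t = m.
  apply/mnmP => i; rewrite mnmE; case: insubP => [i' _ <-|].
    by rewrite ffunE inordK // ltnS (leq_trans (mnm_le_mdeg m _)).
  rewrite inE negbK => iw; move/eqP: w0; rewrite sum_nat_eq0.
  by move/forall_inP/(_ i iw)/eqP.
move/matrixP/(_ 0 (enum_rank t)): vA; rewrite !mxE.
rewrite (reindex _ (onW_bij _ (enum_rank_bij J))) => sum0.
apply/eqP; rewrite -[RHS]sum0; apply: eq_bigr => j' _.
by rewrite mcoeffZ mxE !enum_rankK tm.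
Qed.

Lemma prime_chain_le w l (p : nat -> {mpoly K[n]} -> Prop) :
  (forall i, (i <= l)%N -> is_prime_ideal (p i)) ->
  (forall i, (i < l)%N ->
     (forall f, p i f -> p i.+1 f) /\ exists f, p i.+1 f /\ ~ p i f) ->
  (forall i, i \in w -> p 0%N 'X_i) -> (l <= n - #|w|)%N.
Proof.
move=> p_prime p_lt pw; have [D DP] := chain_independent p_prime p_lt.
move: (n - #|w|)%N (@independent_card w) => d card_le.
(* As N exceeds (D+1)^d, one gets (D N + 1)^d <= ((D+1) N)^d < N^(d+1) <= N^l, against the bound on
   the independent family. *)
rewrite leqNgt; apply/negP => ltdl; pose N := (D.+1 ^ d).+1.
have [J [b [cardJ size_b b_indep]]] := DP N.
have : (N ^ l <= (D * N).+1 ^ d)%N.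
  rewrite -cardJ; apply: card_le size_b _ => c cw; apply: b_indep.
  by apply: wideal_sub_ideal cw => //; case: (p_prime 0%N isT).
apply/negP; rewrite -ltnNge.
apply: (@leq_ltn_trans ((D.+1 * N) ^ d)).
  have [->|d_gt0] := posnP d; first by rewrite !expn0.
  by rewrite leq_exp2r // mulSn -[X in (X <= _)%N]add1n leq_add2r.
apply: (@leq_trans (N ^ d.+1)); last by rewrite leq_pexp2l.
by rewrite expnMn expnS ltn_pmul2r ?expn_gt0.
Qed.

Lemma wideal_mono w u s s' f :
  w \subset u -> (s' <= s)%N -> wideal w s f -> wideal u s' f.
Proof.
move=> wu ss fs m /fs sm; apply: leq_trans ss (leq_trans sm _).
rewrite /wdeg [X in (_ <= X)%N](bigID (mem w)) /=.
under [X in (_ <= X + _)%N]eq_bigl => i do rewrite andbC (andb_idr (subsetP wu i)).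
exact: leq_addr.
Qed.

Lemma widealXn w s f : wideal w 1 f -> wideal w s (f ^+ s).
Proof.
move=> fw; elim: s => [|s IH]; first by move=> m.
by rewrite exprS; apply: (@widealM _ _ _ 1 s).
Qed.

Lemma is_krull_dim_capw (W : {set {set 'I_n}}) s w :
  (0 < s)%N -> w \in W -> (forall u, u \in W -> #|w| <= #|u|)%N ->
  is_krull_dim (@capw K n W s) (n - #|w|).
Proof.
move=> s_gt0 wW w_min; split=> [|l p [p_prime p_lt]].
  (* A chain of full length starts at P_w and adjoins the remaining variables one at a time. *)
  left; pose q := enum (~: w); pose U j := w :|: [set i in take j q].
  exists (fun j => wideal (U j) 1); split=> [i _|i id].
    split=> [|f fW]; first exact: wideal_prime.
    by apply: wideal_mono (fW _ wW); rewrite ?subsetUl.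
  have size_q : size q = (n - #|w|)%N by rewrite -cardE cardsCs setCK card_ord.
  have x0 : 'I_n by apply: (@Ordinal n i); apply: leq_trans id (leq_subr _ _).
  have qi : nth x0 q i \in q by rewrite mem_nth ?size_q.
  have iq : index (nth x0 q i) q = i by rewrite index_uniq ?enum_uniq ?size_q.
  split=> [f|].
    apply: wideal_mono => //; apply: setUS; apply/subsetP => j; rewrite !inE.
    move=> jq; have jq' := mem_take jq; move: jq; rewrite !in_take //; exact: leqW.
  exists 'X_(nth x0 q i); split.
    by apply: widealU; rewrite !inE in_take // iq ltnS leqnn orbT.
  rewrite widealX wdegU lt0b !inE in_take // iq ltnn orbF.
  by move: qi; rewrite mem_enum inE => /negP.
(* Otherwise each P_u has an element [h u] outside p_0. The product of their s-th powers lies in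
   [capw W s], hence in p_0, against primality. *)
have [u uW pu] : exists2 u, u \in W & forall i, i \in u -> p 0%N 'X_i.
  have [p0 pW] := p_prime 0%N isT; apply: NNPP => no_u.
  have /fin_all_exists[h hP] (u : {set 'I_n}) : exists h : {mpoly K[n]}, u \in W ->
      wideal u 1 h /\ ~ p 0%N h.
    apply: NNPP => no_h; apply: no_u; exists u => [|i iu].
      by apply: NNPP => uW; apply: no_h; exists 0 => /uW.
    by apply: NNPP => pi; apply: no_h; exists 'X_i => _; split=> //; apply: widealU.
  have : p 0%N (\prod_(u in W) h u ^+ s).
    apply: pW => u uW; rewrite (bigD1 u) //=; apply: widealMl.
    by apply: widealXn; case: (hP u uW).
  case/(prime_prod p0) => u /hP[_ ph]; rewrite -(card_ord s) -prodr_const.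
  by case/(prime_prod p0).
by apply: leq_trans (prime_chain_le _ p_lt pu) (leq_sub2l _ (w_min _ uW)) => i /p_prime[].
Qed.

End KrullDimension.

(** * Standard monomials and the Hilbert series *)

Section HilbertSeries.

Variables (n : nat) (W : {set {set 'I_n}}) (s : nat).
Implicit Types (w u : {set 'I_n}) (m : 'X_{1..n}) (k : nat).

(** The monomials outside the ideal; their classes form a K-basis of the quotient. *)
Definition standard m : bool := [exists w in W, wdeg w m < s]%N.

Lemma capw_standard (K : fieldType) (f : {mpoly K[n]}) :
  capw W s f <-> forall m, m \in msupp f -> ~~ standard m.
Proof.
split=> [fW m mf | fW w wW m mf].
  by apply/exists_inPn => w wW; rewrite -leqNgt; apply: fW.
by have /exists_inPn/(_ w wW) := fW m mf; rewrite -leqNgt.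
Qed.

Definition mnm_ffun N (f : {ffun 'I_n -> 'I_N}) : 'X_{1..n} :=
  [multinom nat_of_ord (f i) | i < n].

Lemma mnm_ffun_inj N : injective (@mnm_ffun N).
Proof.
move=> f g /mnmP fg; apply/ffunP => i; apply: val_inj.
by have := fg i; rewrite !mnmE.
Qed.

Definition std_monomials N k : seq 'X_{1..n} :=
  [seq mnm_ffun f | f <- enum {ffun 'I_n -> 'I_N}
     & standard (mnm_ffun f) && (mdeg (mnm_ffun f) == k)].

Definition hilbert_fun k : nat := size (std_monomials k.+1 k).

Lemma std_monomials_uniq N k : uniq (std_monomials N k).
Proof.
rewrite map_inj_uniq; first by rewrite filter_uniq ?enum_uniq.
exact: mnm_ffun_inj.
Qed.

Lemma mem_std_monomials N k m :
  (k < N)%N -> (m \in std_monomials N k) = standard m && (mdeg m == k).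
Proof.
move=> kN; apply/mapP/idP => [[f] | /andP[mW /eqP mk]].
  by rewrite mem_filter => /andP[? _] ->.
have mN i : (m i < N)%N by apply: leq_ltn_trans (mnm_le_mdeg m i) _; rewrite mk.
exists [ffun i => Ordinal (mN i)].
  rewrite mem_filter mem_enum andbT.
  have -> : mnm_ffun [ffun i => Ordinal (mN i)] = m.
    by apply/mnmP => i; rewrite mnmE ffunE.
  by rewrite mW mk eqxx.
by apply/mnmP => i; rewrite mnmE ffunE.
Qed.

Lemma size_std_monomials N k :
  (k < N)%N -> size (std_monomials N k) = hilbert_fun k.
Proof.
move=> kN; apply/perm_size/uniq_perm; rewrite ?std_monomials_uniq // => m.
by rewrite !mem_std_monomials.
Qed.

Lemma is_graded_dim_capw (K : fieldType) k :
  is_graded_dim (@capw K n W s) k (hilbert_fun k).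
Proof.
pose r := in_tuple (std_monomials k.+1 k).
have rP i : standard (tnth r i) && (mdeg (tnth r i) == k).
  by rewrite -(mem_std_monomials _ (ltnSn k)) mem_tnth.
have coef_r (c : 'I_(hilbert_fun k) -> K) j :
    (\sum_i c i *: 'X_[tnth r i])@_(tnth r j) = c j.
  rewrite raddf_sum (bigD1 j) //= mcoeffZ mcoeffX eqxx mulr1 big1 ?addr0 // => i ij.
  rewrite mcoeffZ mcoeffX; case: eqP => [|_]; last by rewrite mulr0.
  by move/(tuple_uniqP r (std_monomials_uniq k.+1 k))/eqP; rewrite (negPf ij).
exists (fun i => 'X_[tnth r i]); split=> [i|c /capw_standard cW i|f /dhomogP f_homog].
- by rewrite dhomogX; case/andP: (rP i).
- apply/eqP; apply: contraT => ci; have /andP[std_i _] := rP i.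
  by have := cW (tnth r i); rewrite mcoeff_msupp coef_r std_i => /(_ ci).
exists (fun i => f@_(tnth r i)); apply/capw_standard => m; rewrite mcoeff_msupp.
apply: contra => mW; rewrite mcoeffB subr_eq0.
have [mk | mk] := eqVneq (mdeg m) k.
  have /tnthP[j ->] : m \in r by rewrite mem_std_monomials // mW mk /=.
  by rewrite coef_r.
rewrite memN_msupp_eq0; last by apply: contra mk => /f_homog ->.
rewrite eq_sym raddf_sum big1 // => i _; rewrite /= mcoeffZ mcoeffX.
case: eqP => [e|_]; last by rewrite mulr0.
by case/andP: (rP i) mk; rewrite e => _ /eqP->; rewrite eqxx.
Qed.

(** A polynomial stand-in for the Hilbert series, faithful in degrees below N. *)
Definition hilbert_trunc N : {poly int} :=
  \sum_(f : {ffun 'I_n -> 'I_N} | standard (mnm_ffun f)) 'X^(mdeg (mnm_ffun f)).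

Lemma coef_hilbert_trunc N k :
  (k < N)%N -> (hilbert_trunc N)`_k = (hilbert_fun k)%:Z.
Proof.
move=> kN; rewrite -(size_std_monomials kN) size_map size_filter -sum1_count.
rewrite big_enum_cond /= coef_sum -natz natr_sum big_mkcondr /=.
by apply: eq_bigr => f _; rewrite coefXn eq_sym; case: eqP.
Qed.

Definition truncate N (f : {ffun 'I_n -> 'I_N}) : {ffun 'I_n -> 'I_s.+1} :=
  [ffun i => inord (minn (f i) s)].

Definition full (g : {ffun 'I_n -> 'I_s.+1}) : {set 'I_n} :=
  [set i | g i == s :> nat].

(** The sum of t^|g| / (1 - t)^|full g| over standard g, brought to the denominator (1 - t)^d; the
    subtraction is exact when [#|full g| <= d]. *)
Definition hilbert_num d : {poly int} :=
  \sum_(g : {ffun 'I_n -> 'I_s.+1} | standard (mnm_ffun g))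
     (1 - 'X) ^+ (d - #|full g|) * 'X^(mdeg (mnm_ffun g)).

Lemma truncateE N (f : {ffun 'I_n -> 'I_N}) i : truncate f i = minn (f i) s :> nat.
Proof. by rewrite ffunE inordK // ltnS geq_minr. Qed.

(** If all exponents on w are below s, truncation does not change them; otherwise one of them alone
    brings both degrees to at least s. *)
Lemma standard_truncate N (f : {ffun 'I_n -> 'I_N}) :
  standard (mnm_ffun (truncate f)) = standard (mnm_ffun f).
Proof.
apply: eq_existsb => w; congr (_ && _); rewrite /wdeg.
under eq_bigr do rewrite mnmE truncateE.
under [in RHS]eq_bigr do rewrite mnmE.
have [/forall_inP f_lt | /forall_inPn[i iw]] := boolP [forall i in w, f i < s]%N.
  by congr (_ < _)%N; apply: eq_bigr => i /f_lt /ltnW /minn_idPl.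
rewrite -leqNgt => si; rewrite !(bigD1 i iw) /= (minn_idPr si).
by rewrite !ltnNge leq_addr (leq_trans si (leq_addr _ _)).
Qed.

Lemma coefM_congr N (p p' q q' : {poly int}) :
  (forall k, (k < N)%N -> p`_k = p'`_k) -> (forall k, (k < N)%N -> q`_k = q'`_k) ->
  forall k, (k < N)%N -> (p * q)`_k = (p' * q')`_k.
Proof.
move=> pp qq k kN; rewrite !coefM; apply: eq_bigr => i _.
by rewrite pp ?qq // (leq_ltn_trans _ kN) // ?leq_subr // -ltnS.
Qed.

(** Modulo t^N: a value a < s comes only from the exponent a, whereas a = s collects the tail t^s +
    t^(s+1) + ..., which is t^s / (1 - t). *)
Lemma fiber_factor N (a : 'I_s.+1) : (s < N)%N ->
  forall k, (k < N)%N ->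
  ((1 - 'X) ^+ (a == s :> nat) * \sum_(j < N | minn j s == a) 'X^j : {poly int})`_k
    = ('X^a : {poly int})`_k.
Proof.
move=> sN k kN; set q := \sum_(j < N | _) _.
have q_coef j : (j < N)%N -> q`_j = (minn j s == a)%:R.
  move=> jN; rewrite coef_sum big_mkcond (bigD1 (Ordinal jN)) //= coefXn eqxx.
  rewrite big1 ?addr0 => [|i ij]; first by case: eqP.
  case: ifP => // _; rewrite coefXn; case: eqP => // e.
  by case/eqP: ij; apply: val_inj.
rewrite coefXn; have as_ := ltn_ord a; have [ea | a_neq] := eqVneq (a : nat) s.
  rewrite expr1 mulrBl mul1r coefB coefXM q_coef //; case: k kN => [|k] kN /=.
    by rewrite subr0; congr (_%:R); lia.
  rewrite q_coef 1?ltnW // ea.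
  have -> : (minn k.+1 s == s) = (k.+1 == s) || (s <= k)%N by lia.
  have -> : (minn k s == s) = (s <= k)%N by lia.
  by case: eqVneq => [<-|_]; rewrite ?ltnn ?subr0 ?subrr.
by rewrite expr0 mul1r q_coef //; congr (_%:R); lia.
Qed.

(** The fibre of truncation over g is a product over the variables, so its generating polynomial
    factors. *)
Lemma fiber_sum N (g : {ffun 'I_n -> 'I_s.+1}) : (s < N)%N ->
  forall k, (k < N)%N ->
  ((1 - 'X) ^+ #|full g| * \sum_(f : {ffun 'I_n -> 'I_N} | truncate f == g)
      'X^(mdeg (mnm_ffun f)) : {poly int})`_k = ('X^(mdeg (mnm_ffun g)) : {poly int})`_k.
Proof.
move=> sN.
have -> : \sum_(f : {ffun 'I_n -> 'I_N} | truncate f == g) 'X^(mdeg (mnm_ffun f))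
    = \prod_i \sum_(j < N | minn j s == g i) 'X^j :> {poly int}.
  rewrite bigA_distr_big_dep; apply: eq_big => [f | f _].
    apply/eqP/familyP => [<- i | fg]; first by rewrite unfold_in truncateE.
    by apply/ffunP => i; apply: val_inj; rewrite /= truncateE; apply/eqP/fg.
  by rewrite mdegE -prodrXr; apply: eq_bigr => i _; rewrite mnmE.
have -> : (1 - 'X) ^+ #|full g| = \prod_i (1 - 'X) ^+ (g i == s :> nat) :> {poly int}.
  rewrite prodrXr -sum1_card big_mkcond; congr (_ ^+ _).
  by apply: eq_bigr => i _; rewrite inE; case: eqP.
have -> : mdeg (mnm_ffun g) = (\sum_i g i)%N.
  by rewrite mdegE; apply: eq_bigr => i _; rewrite mnmE.
rewrite -big_split /= -prodrXr.
apply: (big_ind2 (fun p q : {poly int} => forall k, (k < N)%N -> p`_k = q`_k)) => //.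
  by move=> p p' q q'; apply: coefM_congr.
by move=> i _; apply: fiber_factor.
Qed.

Lemma hilbert_series d k :
  (forall g : {ffun 'I_n -> 'I_s.+1}, standard (mnm_ffun g) -> (#|full g| <= d)%N) ->
  \sum_(i < k.+1) ((1 - 'X) ^+ d : {poly int})`_i * (hilbert_fun (k - i)%N)%:Z
    = (hilbert_num d)`_k.
Proof.
(* N exceeds k, to read off the coefficient, and s, as [fiber_sum] requires. *)
move=> full_le; pose N := (k + s).+1; have kN : (k < N)%N by rewrite ltnS leq_addr.
under eq_bigr => i _ do
  rewrite -(coef_hilbert_trunc (leq_ltn_trans (leq_subr i k) kN)).
rewrite -coefM /hilbert_trunc.
rewrite (partition_big (@truncate N) (fun g => standard (mnm_ffun g))) => [|f]; last first.
  by rewrite standard_truncate.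
rewrite mulr_sumr !coef_sum; apply: eq_bigr => g g_std.
rewrite -{1}(subnK (full_le g g_std)) exprD -mulrA.
apply: coefM_congr kN => // j jN; rewrite -[RHS](@fiber_sum N) ?ltnS ?leq_addl //.
congr ((_ * _ : {poly int})`_j); apply: eq_bigl => f.
have [fg|] := eqVneq (truncate f) g; last by rewrite andbF.
by rewrite -standard_truncate fg g_std.
Qed.

(** * The value of the numerator at 1 *)

Section Multiplicity.

Variable c : nat.
Hypothesis W_ge : forall w, w \in W -> (c <= #|w|)%N.
Implicit Types g : {ffun 'I_n -> 'I_s.+1}.

Lemma wdeg_lt_full g w : (wdeg w (mnm_ffun g) < s)%N -> w \subset ~: full g.
Proof.
move=> ws; apply/subsetP => i iw; rewrite !inE; apply: contraTneq ws => gi.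
by rewrite /wdeg (bigD1 i) //= mnmE gi -leqNgt leq_addr.
Qed.

Lemma standard_full g : standard (mnm_ffun g) -> (#|full g| <= n - c)%N.
Proof.
case/exists_inP => w wW /wdeg_lt_full/subset_leq_card; have := W_ge wW.
have := cardsC (full g); rewrite card_ord; lia.
Qed.

Lemma standard_full_eq g :
  (c <= n)%N -> standard (mnm_ffun g) -> #|full g| = (n - c)%N ->
  [/\ ~: full g \in W, #|~: full g| = c & wdeg (~: full g) (mnm_ffun g) < s]%N.
Proof.
move=> cn /exists_inP[w wW ws] gc; have wg := wdeg_lt_full ws.
have cardg : #|~: full g| = c by have := cardsC (full g); rewrite card_ord; lia.
(* w lies in a set of size c and has at least c elements itself. *)
have wE : w = ~: full g by apply/eqP; rewrite eqEcard wg cardg W_ge.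
by rewrite cardg -wE.
Qed.

Lemma card_standard_max : (c <= n)%N ->
  #|[set g | standard (mnm_ffun g) & #|full g| == (n - c)%N]| =
  (\sum_(w in W | #|w| == c)
     #|[set g | (wdeg w (mnm_ffun g) < s)%N & full g == ~: w]|)%N.
Proof.
move=> cn; rewrite -sum1_card.
rewrite (partition_big (fun g => ~: full g) (fun w => (w \in W) && (#|w| == c))).
  apply: eq_bigr => w /andP[wW /eqP wc]; rewrite -sum1_card; apply: eq_bigl => g.
  rewrite !inE; apply/andP/andP => [[/andP[g_std /eqP gc] /eqP <-]|[ws /eqP gw]].
    by have [_ _ ->] := standard_full_eq cn g_std gc; rewrite setCK eqxx.
  rewrite gw setCK eqxx; split=> //; apply/andP; split.
    by apply/exists_inP; exists w.
  by apply/eqP; have := cardsC w; rewrite card_ord; lia.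
move=> g; rewrite inE => /andP[g_std /eqP gc].
by have [-> -> _] := standard_full_eq cn g_std gc; rewrite eqxx.
Qed.

(** At t = 1 the factor (1 - t)^(n - c - |full g|) kills every g of smaller pole order, and each
    remaining g contributes 1. *)
Lemma horner_hilbert_num : (c <= n)%N ->
  (hilbert_num (n - c)).[1] =
  (\sum_(w in W | #|w| == c)
     #|[set g | (wdeg w (mnm_ffun g) < s)%N & full g == ~: w]|)%N%:Z.
Proof.
move=> cn; rewrite -(card_standard_max cn) -sum1_card -natz natr_sum.
rewrite horner_sum [RHS]big_mkcond [LHS]big_mkcond /=; apply: eq_bigr => g _.
rewrite inE; case: ifP => //= /standard_full gc.
rewrite hornerM !hornerE subrr expr1n mulr1.
have [->|ne] := eqVneq; first by rewrite subnn.
by rewrite expr0n subn_eq0 leqNgt ltn_neqAle ne gc.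
Qed.

End Multiplicity.

End HilbertSeries.

(** * The binomial coefficient and the multiplicity formula *)

Lemma card_fixed_full n s (w : {set 'I_n}) : (0 < s)%N ->
  #|[set g : {ffun 'I_n -> 'I_s.+1} | (wdeg w (mnm_ffun g) < s)%N & full g == ~: w]|
  = 'C(#|w| + s - 1, #|w|).
Proof.
case: s => // s _; rewrite addnS subn1 /= -card_partial_ord_partitions.
(* The former s is now s + 1. Such a g equals s + 1 off w and is on w a tuple of sum at most s;
   [phi] is this bijection onto the counted set. *)
pose phi (t : #|w|.-tuple 'I_s.+1) : {ffun 'I_n -> 'I_s.+2} :=
  [ffun i => if insub (index i (enum w)) is Some j
             then widen_ord (leqnSn _) (tnth t j) else ord_max].
have phi_in t (j : 'I_#|w|) : phi t (enum_val j) = tnth t j :> nat.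
  have e : index (enum_val j) (enum w) = j.
    by rewrite /enum_val index_uniq ?enum_uniq // -cardE.
  by rewrite ffunE e valK.
have phi_out t i : i \notin w -> phi t i = s.+1 :> nat.
  move=> iw; rewrite ffunE insubF //; apply/negbTE.
  by rewrite -leqNgt cardE leqNgt index_mem mem_enum.
have wdeg_phi t : wdeg w (mnm_ffun (phi t)) = (\sum_(i <- t) i)%N.
  rewrite /wdeg big_enum_val big_tuple; apply: eq_bigr => j _.
  by rewrite mnmE phi_in.
have phi_inj : injective phi.
  move=> t u tu; apply: eq_from_tnth => j; apply: val_inj.
  by rewrite /= -!phi_in tu.
rewrite -(card_imset _ phi_inj); apply: eq_card => g; rewrite inE.
apply/andP/imsetP => [[gw /eqP g_full]|[t]].
  have g_lt i : i \in w -> (g i < s.+1)%N.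
    move=> iw; have : i \notin full g by rewrite g_full inE negbK.
    by rewrite inE => gi; rewrite ltn_neqAle gi -ltnS ltn_ord.
  pose t := [tuple inord (g (enum_val j)) : 'I_s.+1 | j < #|w|].
  have gE : g = phi t.
    apply/ffunP => i; apply: val_inj; rewrite /=.
    have [iw|iw] := boolP (i \in w).
      by rewrite -(enum_rankK_in iw iw) phi_in tnth_mktuple inordK // g_lt // enum_valP.
    rewrite phi_out //; apply/eqP.
    have : i \in full g by rewrite g_full inE.
    by rewrite inE.
  by exists t => //; rewrite inE -ltnS -wdeg_phi -gE.
rewrite inE -wdeg_phi ltnS => tw ->; split=> //.
apply/eqP/setP => i; rewrite !inE; have [iw|iw] := boolP (i \in w).
  by rewrite -(enum_rankK_in iw iw) phi_in ltn_eqF.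
by rewrite phi_out ?eqxx.
Qed.

(** The dimension is a hypothesis so that the case of empty W, with c = n, is covered as well. *)
Lemma is_multiplicity_capw (K : fieldType) n (W : {set {set 'I_n}}) s c :
  (0 < s)%N -> (c <= n)%N -> (forall w, w \in W -> c <= #|w|)%N ->
  is_krull_dim (@capw K n W s) (n - c) ->
  is_multiplicity (@capw K n W s)
    (Posz ('C(c + s - 1, c) * #|[set w in W | #|w| == c]|)%N).
Proof.
move=> s_gt0 cn W_ge dimW.
exists (n - c)%N, (hilbert_fun W s), (hilbert_num W s (n - c)); split=> //.
- by move=> k; apply: is_graded_dim_capw.
- by move=> k; apply: hilbert_series => g; apply: standard_full.
rewrite horner_hilbert_num //; congr Posz.
rewrite (eq_bigr (fun=> 'C(c + s - 1, c))) => [|w /andP[_ /eqP <-]]; last first.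
  exact: card_fixed_full.
by rewrite sum_nat_const mulnC; congr (_ * _)%N; apply: eq_card => w; rewrite !inE.
Qed.

(** A vertex cover of least cardinality is also minimal for inclusion. *)
Lemma cover_number_min n (e : rel 'I_n) :
  exists2 w, w \in min_covers e &
    #|w| = cover_number e /\ forall u, u \in min_covers e -> (#|w| <= #|u|)%N.
Proof.
rewrite /cover_number; case: arg_minnP => [|w cw w_min].
  by apply/vertex_coverP => i j _; left; rewrite inE.
exists w; last by split=> // u; rewrite inE => /minsetp/w_min.
rewrite inE; apply/minsetP; split=> // u /w_min wu uw.
by apply/eqP; rewrite eqEcard uw wu.
Qed.

Lemma is_krull_dim_full (R : comNzRingType) (I : R -> Prop) :
  (forall f, I f) -> is_krull_dim I 0.
Proof.
move=> If; split=> [|l p [p_prime _]]; first by right.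
by have [[_ p1 _] pI] := p_prime 0 isT; case: p1; apply: pI.
Qed.

End SquarefreeSymbolicPowers.

Theorem corollary5p3 (K : fieldType) (n : nat) (e : rel 'I_n)
    (e_sym : ssrbool.symmetric e) (e_irr : irreflexive e) (s : nat) (s_ge1 : (1 <= s)%N) :
  is_multiplicity (symbolic_power (edge_ideal K e) s)
    (Posz ('C(cover_number e + s - 1, cover_number e) * num_minimum_covers e))
  /\
  is_multiplicity (symbolic_power (cover_ideal K e) s)
    (Posz ('C(s + 1, 2) * #|edge_set e|)).
Proof.
split.
  rewrite edge_ideal_capw // symbolic_power_capw; last exact: min_covers_antichain.
  have [w wW [wc w_min]] := cover_number_min e.
  have -> : num_minimum_covers e = #|[set u in min_covers e | #|u| == cover_number e]|.
    by apply: eq_card => u; rewrite !inE.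
  rewrite -wc; apply: is_multiplicity_capw => //; last exact: is_krull_dim_capw.
  by rewrite -[X in (_ <= X)%N](card_ord n) max_card.
rewrite cover_ideal_capw symbolic_power_capw; last exact: edge_set_antichain.
have [E0|[w wE]] := set_0Vmem (edge_set e).
  (* The dimension is then 0 by convention, which is n - c for c = n. *)
  rewrite E0 cards0 muln0.
  have -> : 0 = ('C(n + s - 1, n) * #|[set w in edge_set e | #|w| == n]|)%N.
    by rewrite E0; apply/esym/eqP; rewrite muln_eq0 cards_eq0; apply/orP; right;
       apply/eqP/setP => w; rewrite !inE.
  rewrite -E0; apply: is_multiplicity_capw => // [w|]; first by rewrite E0 inE.
  by rewrite subnn; apply: is_krull_dim_full => f w; rewrite E0 inE.
(* Every edge has two vertices, so c = 2 and all of W is counted. *)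
have -> : #|edge_set e| = #|[set u in edge_set e | #|u| == 2]|.
  by apply: eq_card => u; rewrite [RHS]inE; case: (boolP (u \in _)) => // /card_edge->.
have -> : (s + 1 = 2 + s - 1)%N by lia.
apply: is_multiplicity_capw => // [|u /card_edge->//|].
  by rewrite -(card_edge e_irr wE) -[X in (_ <= X)%N](card_ord n) max_card.
rewrite -(card_edge e_irr wE); apply: is_krull_dim_capw => // u.
by move=> /card_edge->; rewrite ?(card_edge e_irr wE).
Qed.
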